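(* Let $d$ be a metric on $\mathfrak H_{\mathbb K}$, and denote again by $d$ its extension to $\partial\mathbf{H}^n_{\mathbb K}=\mathfrak H_{\mathbb K}\cup\{\infty\}$. Suppose that both of the following hold: (Sim) $\mathrm{Sim}_{d_{\mathfrak H}}\subseteq\mathrm{Sim}_d$; (Top) every sequence $(p_\nu)_{\nu\in\mathbb N}$ in $\partial\mathbf{H}^n_{\mathbb K}$ which converges in the $d_{\mathfrak H}$-topology of $\partial\mathbf{H}^n_{\mathbb K}$ converges in the $d$-topology of $\partial\mathbf{H}^n_{\mathbb K}$. Then: 1. If $\mathbb K=\mathbb R$, there exist constants $\beta>0$ and $\alpha\in(0,1]$ such that $d=\beta\cdot d_{\mathfrak H}^{\alpha}$. 2. If $\mathbb K\neq\mathbb R$, there exist constants $\alpha\in(0,1]$ and $\beta>0$ such that $d(p,q)\le\beta\cdot d_{\mathfrak H}^{\alpha}(p,q)$ for all $p,q\in\partial\mathbf{H}^n_{\mathbb K}$.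
   Context: $\mathbb K$ is one of $\mathbb R,\mathbb C,\mathbb H,\mathbb O$ (reals, complex numbers, quaternions, octonions), with conjugation $z\mapsto\overline z$ (the identity if $\mathbb K=\mathbb R$) and norm $|z|$; $n\ge 2$ is an integer, and $n=2$ if $\mathbb K=\mathbb O$. Put $\Im(\mathbb K)=\{z\in\mathbb K: z=-\overline z\}$, $\operatorname{Im}z=(z-\overline z)/2$, and $\|\zeta\|^2=\sum_i|\zeta_i|^2$ for $\zeta\in\mathbb K^{n-1}$. The $\mathbb K$-Heisenberg group $\mathfrak H_{\mathbb K}$ is the set $\mathbb K^{n-1}\times\Im(\mathbb K)$ with the multiplication $(\zeta,v)*(\zeta',v')=(\zeta+\zeta',\,v+v'+2\omega(\zeta,\zeta'))$, where $\omega(\zeta,\zeta')=\operatorname{Im}\big(\sum_i\overline{\zeta'_i}\zeta_i\big)$; thus $(\zeta,v)^{-1}=(-\zeta,-v)$, and the origin is $o=(0,0)$. The boundary of $\mathbb K$-hyperbolic space is identified with $\partial\mathbf{H}^n_{\mathbb K}=\mathfrak H_{\mathbb K}\cup\{\infty\}$. The Korányi gauge is $|(\zeta,v)|_{\mathbb K}=(\|\zeta\|^4+|v|^2)^{1/4}$ and the Korányi metric is $d_{\mathfrak H}(p,q)=|q^{-1}*p|_{\mathbb K}$ on $\mathfrak H_{\mathbb K}$. Any metric $d$ on $S=\mathfrak H_{\mathbb K}$ (in particular $d_{\mathfrak H}$) is extended to $\overline S=S\cup\{\infty\}$ by $d(p,\infty)=+\infty$ for $p\in S$ and $d(\infty,\infty)=0$.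 The $d$-topology on $\overline S$ is the one extending the metric topology of $S$ for which the sets $\{q\in S:d(o,q)>R\}\cup\{\infty\}$, $R>0$, are basic neighbourhoods of $\infty$. For pairwise distinct $p_1,\dots,p_4\in\overline S$ the metric cross-ratio is $|\mathbb X^d|(p_1,p_2,p_3,p_4)=\frac{d(p_4,p_2)}{d(p_4,p_1)}\cdot\frac{d(p_3,p_1)}{d(p_3,p_2)}$, where, if one of the points is $\infty$, the two factors containing $\infty$ are cancelled. The Möbius group $\mathcal M_d$ is the group of homeomorphisms of $\overline S$ (in the $d$-topology) which leave $|\mathbb X^d|$ invariant on all quadruples of pairwise distinct points. The similarity group $\mathrm{Sim}_d$ is the set of $\phi\in\mathcal M_d$ for which there is a constant $K(\phi)>0$ with $d(\phi(p),\phi(q))=K(\phi)\,d(p,q)$ for all $p,q\in S$. *)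

(* Defs.v *)
From HB Require Import structures.
From mathcomp Require Import all_boot all_order all_algebra.
From mathcomp Require Import all_classical all_reals all_analysis.

Set Implicit Arguments.
Unset Strict Implicit.
Unset Printing Implicit Defensive.

Import Order.TTheory GRing.Theory Num.Theory.

Local Open Scope classical_set_scope.
Local Open Scope ring_scope.

(* R, C, H and O are levels 0 to 3 of the Cayley-Dickson construction:
   (a, b) stands for a + b l, with
     (a, b) (c, d) = (a c - d^* b, d a + b c^* )  and  (a, b)^* = (a^*, - b).
   Only the module structure is a canonical instance: the canonical product of
   a pair type is componentwise, hence not the one wanted here. *)
Section CayleyDickson.
Variable R : realType.

Fixpoint cd (k : nat) : lmodType R :=
  if k is k'.+1 then (cd k' * cd k')%type else R^o.

Fixpoint cd_conj (k : nat) : cd k -> cd k :=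
  match k return cd k -> cd k with
  | 0 => fun z => z
  | k'.+1 => fun z => (cd_conj z.1, - z.2)
  end.

Fixpoint cd_mul (k : nat) : cd k -> cd k -> cd k :=
  match k return cd k -> cd k -> cd k with
  | 0 => fun z w => (z : R) * (w : R)
  | k'.+1 => fun z w =>
      (cd_mul z.1 w.1 - cd_mul (cd_conj w.2) z.2,
       cd_mul w.2 z.1 + cd_mul z.2 (cd_conj w.1))
  end.

Fixpoint cd_normsq (k : nat) : cd k -> R :=
  match k return cd k -> R with
  | 0 => fun z => (z : R) ^+ 2
  | k'.+1 => fun z => cd_normsq z.1 + cd_normsq z.2
  end.

Definition cd_norm (k : nat) (z : cd k) : R := Num.sqrt (cd_normsq z).

Lemma cd_conjK (k : nat) : involutive (@cd_conj k).
Proof. by elim: k => [//|k IH] z; rewrite /= IH opprK -surjective_pairing. Qed.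

Lemma cd_conjB (k : nat) : {morph @cd_conj k : z w / z - w}.
Proof.
elim: k => [//|k IH] z w /=.
by congr pair; [exact: IH | rewrite /= opprD].
Qed.

Lemma cd_conjZ (k : nat) (a : R) : {morph @cd_conj k : z / a *: z}.
Proof.
elim: k => [//|k IH] z /=.
by congr pair; [exact: IH | rewrite /= scalerN].
Qed.

Definition cd_imaginary (k : nat) : {pred cd k} :=
  [pred z | z == - cd_conj z].

Fact cd_imaginary_zmod_closed (k : nat) : zmod_closed (@cd_imaginary k).
Proof.
split=> [|z w /eqP zE /eqP wE]; rewrite inE.
  by rewrite -(subrr (0 : cd k)) cd_conjB !subrr oppr0.
by rewrite cd_conjB opprB {1}zE {1}wE opprK addrC.
Qed.

HB.instance Definition _ (k : nat) :=
  GRing.isZmodClosed.Build (cd k) (@cd_imaginary k)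
    (cd_imaginary_zmod_closed k).

Record imag (k : nat) := Imag {
  imag_val :> cd k;
  imagP : imag_val \in @cd_imaginary k
}.

HB.instance Definition _ (k : nat) := [isSub for @imag_val k].
HB.instance Definition _ (k : nat) := [Choice of imag k by <:].
HB.instance Definition _ (k : nat) :=
  [SubChoice_isSubZmodule of imag k by <:].

Fact cd_im_subproof (k : nat) (z : cd k) :
  2^-1 *: (z - cd_conj z) \in @cd_imaginary k.
Proof. by rewrite inE cd_conjZ cd_conjB cd_conjK -scalerN opprB. Qed.

Definition cd_im (k : nat) (z : cd k) : imag k := Imag (cd_im_subproof z).

End CayleyDickson.

Inductive hyp_algebra := Reals | Complexes | Quaternions | Octonions.

Definition level (K : hyp_algebra) : nat :=
  match K with Reals => 0 | Complexes => 1 | Quaternions => 2 | Octonions => 3 end.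

Section Heisenberg.
Variables (R : realType) (K : hyp_algebra) (n : nat).

Definition heis : Type := ('rV[cd R (level K)]_n.-1 * imag R (level K))%type.

HB.instance Definition _ := Choice.on heis.

Definition heis0 : heis := (0, 0).

Definition heis_omega (z w : 'rV[cd R (level K)]_n.-1) : imag R (level K) :=
  cd_im (\sum_i cd_mul (cd_conj (w 0 i)) (z 0 i)).

Definition heis_mul (p q : heis) : heis :=
  (p.1 + q.1, p.2 + q.2 + heis_omega p.1 q.1 *+ 2).

Definition heis_inv (p : heis) : heis := (- p.1, - p.2).

Definition vec_norm (z : 'rV[cd R (level K)]_n.-1) : R :=
  Num.sqrt (\sum_i cd_norm (z 0 i) ^+ 2).

Definition koranyi_gauge (p : heis) : R :=
  (vec_norm p.1 ^+ 4 + cd_norm (p.2 : cd R (level K)) ^+ 2) `^ (4^-1).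

Definition koranyi_dist (p q : heis) : R :=
  koranyi_gauge (heis_mul (heis_inv q) p).

Definition boundary : Type := option heis.

HB.instance Definition _ := Choice.on boundary.

Record is_metric (d : heis -> heis -> R) : Prop := IsMetric {
  metric_ge0 : forall p q, 0 <= d p q;
  metric_eq0 : forall p q, d p q = 0 <-> p = q;
  metric_sym : forall p q, d p q = d q p;
  metric_triangle : forall p q r, d p r <= d p q + d q r
}.

Definition infinity : boundary := None.

Section Metric.
Variable d : heis -> heis -> R.

(* boundary with the d-topology; the argument d is what the topological
   instance is inferred from *)
Definition ext_space of (heis -> heis -> R) : Type := boundary.

HB.instance Definition _ := Choice.on (ext_space d).

Definition ext_dist (x y : boundary) : \bar R :=
  match x, y with
  | Some p, Some q => (d p q)%:E
  | None, None => 0%E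
  | _, _ => +oo%E
  end.

Definition basic_nbhs (x : boundary) (e : R) : set boundary :=
  if x is Some p then [set Some q | q in [set q | d p q < e]]
  else infinity |` [set Some q | q in [set q | e < d heis0 q]].

Definition ext_open (A : set boundary) : Prop :=
  forall x, A x -> exists2 e, 0 < e & basic_nbhs x e `<=` A.

Fact ext_openT : ext_open setT.
Proof. by move=> x _; exists 1. Qed.

Fact ext_openI : setI_closed ext_open.
Proof.
move=> A B oA oB x [/oA[e e0 eA] /oB[f f0 fB]].
case: x eA fB => [p|] eA fB.
  exists (Num.min e f); first by rewrite lt_min e0 f0.
  move=> _ [q /= + <-]; rewrite lt_min => /andP[qe qf].
  by split; [apply: eA | apply: fB]; exists q.
exists (Num.max e f); first by rewrite lt_max e0.
move=> _ [->|[q /= + <-]]; first by split; [apply: eA | apply: fB]; left.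
rewrite gt_max => /andP[qe qf].
by split; [apply: eA | apply: fB]; right; exists q.
Qed.

Fact ext_open_bigU (I : Type) (f : I -> set boundary) :
  (forall i, ext_open (f i)) -> ext_open (\bigcup_i f i).
Proof.
move=> of_ x [i _ fix_]; have [e e0 ef] := of_ i x fix_.
by exists e => // y /ef fiy; exists i.
Qed.

HB.instance Definition _ :=
  isOpenTopological.Build (ext_space d) ext_openT ext_openI ext_open_bigU.

Lemma nbhs_ext_spaceE (x : ext_space d) (A : set (ext_space d)) : is_metric d ->
  nbhs x A <-> exists2 e, 0 < e & basic_nbhs x e `<=` A.
Proof.
move=> [d0 dI dC dT]; split=> [[B [oB Bx BA]]|[e e0 eA]].
  by have [e e0 eB] := oB _ Bx; exists e => //; apply: subset_trans BA.
exists (basic_nbhs x e); split=> //.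
  case: x {eA} => [p|].
    move=> _ [q /= pq <-]; exists (e - d p q); first by rewrite subr_gt0.
    move=> _ [r /= + <-]; rewrite ltrBrDl => qr.
    by exists r => //=; apply: le_lt_trans qr.
  move=> _ [->|[q /= eq <-]]; first by exists e.
  exists (d heis0 q - e); first by rewrite subr_gt0.
  move=> _ [r /= qr <-]; right; exists r => //=.
  rewrite -(ltrD2r (d r q)); apply: lt_le_trans (dT _ _ _).
  by rewrite -ltrBrDl dC.
case: x {eA} => [p|]; last by left.
by exists p => //=; rewrite (dI p p).2.
Qed.

(* A factor containing infinity is set to 1: in a cross-ratio of pairwise
   distinct points, there are either no such factors, or one in the numerator
   and one in the denominator, which are cancelled. *)
Definition cross_factor (x y : boundary) : R :=
  if (x, y) is (Some p, Some q) then d p q else 1.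

Definition cross_ratio (x1 x2 x3 x4 : boundary) : R :=
  cross_factor x4 x2 / cross_factor x4 x1 *
  (cross_factor x3 x1 / cross_factor x3 x2).

Definition ext_homeo (f : boundary -> boundary) : Prop :=
  continuous (f : ext_space d -> ext_space d) /\
  exists g : boundary -> boundary,
    [/\ cancel f g, cancel g f & continuous (g : ext_space d -> ext_space d)].

Definition mobius_group : set (boundary -> boundary) :=
  [set f | ext_homeo f /\
    forall x1 x2 x3 x4, uniq [:: x1; x2; x3; x4] ->
      cross_ratio (f x1) (f x2) (f x3) (f x4) = cross_ratio x1 x2 x3 x4].

Definition sim_group : set (boundary -> boundary) :=
  [set f | mobius_group f /\
    exists2 c : R, 0 < c &
      forall p q : heis, (ext_dist (f (Some p)) (f (Some q)) =
                          c%:E * ext_dist (Some p) (Some q))%E].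

Definition converges (u : nat -> boundary) : Prop :=
  exists l : ext_space d, (u : nat -> ext_space d) @ \oo --> l.

End Metric.
End Heisenberg.

Arguments koranyi_dist {R K n}.

(* Main.v *)
Require Import Defs.
From mathcomp Require Import all_boot all_order all_algebra.
From mathcomp Require Import all_classical all_reals all_analysis.
From mathcomp Require Import ring lra.

Set Implicit Arguments.
Unset Strict Implicit.
Unset Printing Implicit Defensive.

Import Order.TTheory GRing.Theory Num.Theory.
Local Open Scope classical_set_scope.
Local Open Scope ring_scope.

(** Left translations, dilations and, over the reals, reflections are Korányi
    similarities, hence similarities of [d].  The dilation of factor [2], resp.
    [sqrt 2], conjugates the translation by [(z, 0)], resp. [(0, v)], to its
    square, so the translations are isometries of [d].  The similarity constant
    of the dilation of factor [a] is multiplicative in [a]; (Top) gives that [d]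
    is continuous at the origin, so this constant is less than [1] for [a < 1],
    is monotone, and is a power [a ^ alpha].  The triangle inequality along
    [0, (z, 0), (2 z, 0)] gives [alpha <= 1].  Rescaling a point into a
    neighbourhood of the origin where [d p 0 < 1] gives the upper bound.  Over
    the reals, a reflection exchanges any two vectors of equal norm and is an
    involution, hence an isometry of [d], so [d p 0] depends only on the norm
    of [p]. *)

Section CayleyDicksonTheory.
Variable R : realType.
Implicit Types (k : nat) (a : R).

Lemma cd_conjN k : {morph @cd_conj R k : z / - z}.
Proof. by move=> z; rewrite -scaleN1r cd_conjZ scaleN1r. Qed.

Lemma cd_conjD k : {morph @cd_conj R k : z w / z + w}.
Proof. by move=> z w; rewrite -[w in LHS]opprK cd_conjB cd_conjN opprK. Qed.

Lemma cd_conj0 k : cd_conj (0 : cd R k) = 0.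
Proof. by rewrite -(subrr (0 : cd R k)) cd_conjB !subrr. Qed.

Lemma cd_conj_sum k (I : finType) (F : I -> cd R k) :
  cd_conj (\sum_i F i) = \sum_i cd_conj (F i).
Proof. exact: (big_morph _ (@cd_conjD k) (@cd_conj0 k)). Qed.

Lemma cd_mulD k :
  (forall x y z : cd R k, cd_mul (x + y) z = cd_mul x z + cd_mul y z) /\
  (forall x y z : cd R k, cd_mul x (y + z) = cd_mul x y + cd_mul x z).
Proof.
elim: k => [|k [IHl IHr]]; first by split=> x y z; [exact: mulrDl|exact: mulrDr].
split=> x y z /=; congr pair; rewrite /= ?cd_conjD ?IHl ?IHr ?opprD addrACA //.
Qed.

Lemma cd_mulDr k (x y z : cd R k) : cd_mul x (y + z) = cd_mul x y + cd_mul x z.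
Proof. exact: (cd_mulD k).2. Qed.

Lemma cd_mulZ k a :
  (forall x y : cd R k, cd_mul (a *: x) y = a *: cd_mul x y) /\
  (forall x y : cd R k, cd_mul x (a *: y) = a *: cd_mul x y).
Proof.
elim: k => [|k [IHl IHr]].
  by split=> x y; [rewrite /= -mulrA|rewrite /= mulrCA].
by split=> x y /=; congr pair; rewrite /= ?cd_conjZ ?IHl ?IHr ?scalerBr ?scalerDr.
Qed.

Lemma cd_mulZl k a (x y : cd R k) : cd_mul (a *: x) y = a *: cd_mul x y.
Proof. exact: (cd_mulZ k a).1. Qed.

Lemma cd_mulZr k a (x y : cd R k) : cd_mul x (a *: y) = a *: cd_mul x y.
Proof. exact: (cd_mulZ k a).2. Qed.

Lemma cd_mulNl k (x y : cd R k) : cd_mul (- x) y = - cd_mul x y.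
Proof. by rewrite -scaleN1r cd_mulZl scaleN1r. Qed.

Lemma cd_mulNr k (x y : cd R k) : cd_mul x (- y) = - cd_mul x y.
Proof. by rewrite -scaleN1r cd_mulZr scaleN1r. Qed.

Lemma cd_conjM k (x y : cd R k) :
  cd_conj (cd_mul x y) = cd_mul (cd_conj y) (cd_conj x).
Proof.
elim: k x y => [|k IH] x y; first exact: mulrC.
rewrite /=; congr pair; rewrite /= ?cd_conjB ?IH ?cd_conjK ?cd_conjN.
  by rewrite cd_mulNl cd_mulNr opprK.
by rewrite !cd_mulNl opprD addrC.
Qed.

Lemma cd_normsq_ge0 k (z : cd R k) : 0 <= cd_normsq z.
Proof. by elim: k z => [|k IH] z; [exact: sqr_ge0|rewrite /= addr_ge0]. Qed.

Lemma cd_normsq_eq0 k (z : cd R k) : cd_normsq z = 0 -> z = 0.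
Proof.
elim: k z => [|k IH] z; first by move/eqP; rewrite sqrf_eq0 => /eqP.
move=> /= /eqP; rewrite paddr_eq0 ?cd_normsq_ge0// => /andP[/eqP/IH z1 /eqP/IH z2].
by rewrite [z]surjective_pairing z1 z2.
Qed.

Lemma cd_normsqZ k a (z : cd R k) : cd_normsq (a *: z) = a ^+ 2 * cd_normsq z.
Proof.
by elim: k z => [|k IH] z /=; [exact: exprMn|rewrite !IH mulrDr].
Qed.

Lemma cd_normsqN k (z : cd R k) : cd_normsq (- z) = cd_normsq z.
Proof. by rewrite -scaleN1r cd_normsqZ sqrrN expr1n mul1r. Qed.

Lemma cd_normsq0 k : cd_normsq (0 : cd R k) = 0.
Proof. by rewrite -(scale0r (0 : cd R k)) cd_normsqZ expr0n mul0r. Qed.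

Lemma cd_normsq_conj k (z : cd R k) : cd_normsq (cd_conj z) = cd_normsq z.
Proof. by elim: k z => [//|k IH] z /=; rewrite IH cd_normsqN. Qed.

Lemma cd_normsqD k (x y : cd R k) :
  cd_normsq (x + y) <= 2 * cd_normsq x + 2 * cd_normsq y.
Proof.
elim: k x y => [|k IH] x y /=; last first.
  by have := IH x.1 y.1; have := IH x.2 y.2; lra.
have := sqr_ge0 ((x : R) - y).
rewrite sqrrB (_ : (_ + _ : cd R 0) ^+ 2 = ((x : R) + (y : R)) ^+ 2)// sqrrD; lra.
Qed.

Lemma cd_normsqM k (x y : cd R k) :
  cd_normsq (cd_mul x y) <= 4 ^+ k * (cd_normsq x * cd_normsq y).
Proof.
elim: k x y => [|k IH] x y; first by rewrite /= exprMn expr0 mul1r.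
have le4 (u v : cd R k) (w w' : R) :
    cd_normsq u <= 4 ^+ k * w -> cd_normsq v <= 4 ^+ k * w' ->
  cd_normsq (u + v) <= 4 ^+ k * (2 * w + 2 * w').
  by move=> hu hv; apply: le_trans (cd_normsqD u v) _; lra.
have -> : cd_normsq (cd_mul x y) =
    cd_normsq (cd_mul x.1 y.1 - cd_mul (cd_conj y.2) x.2) +
    cd_normsq (cd_mul y.2 x.1 + cd_mul x.2 (cd_conj y.1)) by [].
set a := cd_normsq x.1; set b := cd_normsq x.2.
set c := cd_normsq y.1; set e := cd_normsq y.2.
apply: (@le_trans _ _ (4 ^+ k * (2 * (a * c) + 2 * (e * b)) +
                       4 ^+ k * (2 * (e * a) + 2 * (b * c)))).
  by apply: lerD; apply: le4; rewrite ?cd_normsqN; apply: le_trans (IH _ _) _;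
    rewrite ?cd_normsq_conj.
rewrite -mulrDr exprSr -mulrA ler_pM2l ?exprn_gt0//.
have -> : cd_normsq x = a + b by [].
have -> : cd_normsq y = c + e by [].
have := mulr_ge0 (cd_normsq_ge0 x.1) (cd_normsq_ge0 y.1).
have := mulr_ge0 (cd_normsq_ge0 x.1) (cd_normsq_ge0 y.2).
have := mulr_ge0 (cd_normsq_ge0 x.2) (cd_normsq_ge0 y.1).
have := mulr_ge0 (cd_normsq_ge0 x.2) (cd_normsq_ge0 y.2).
rewrite -/a -/b -/c -/e; nra.
Qed.

Lemma cd_normsq_sum k (m : nat) (F : 'I_m -> cd R k) :
  cd_normsq (\sum_i F i) <= 2 ^+ m * \sum_i cd_normsq (F i).
Proof.
elim: m F => [|m IH] F; first by rewrite !big_ord0 cd_normsq0 mulr0.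
rewrite !big_ord_recl; apply: le_trans (cd_normsqD _ _) _.
have := IH (fun i => F (lift ord0 i)).
have : 1 <= 2 ^+ m :> R by rewrite exprn_ege1// ler1n.
have := cd_normsq_ge0 (F ord0).
rewrite exprS; set s := \sum_i _; set t := 2 ^+ m; nra.
Qed.

Lemma cd_normE k (z : cd R k) : cd_norm z ^+ 2 = cd_normsq z.
Proof. by rewrite sqr_sqrtr// cd_normsq_ge0. Qed.

Lemma cd_imD k : {morph @cd_im R k : z w / z + w}.
Proof.
move=> z w; apply: val_inj; rewrite /= cd_conjD opprD addrACA scalerDr.
by [].
Qed.

Lemma cd_im_conj k (z : cd R k) : cd_im (cd_conj z) = - cd_im z.
Proof. by apply: val_inj; rewrite /= cd_conjK -scalerN opprB. Qed.

Lemma cd_normsq_im k (z : cd R k) : cd_normsq (imag_val (cd_im z)) <= cd_normsq z.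
Proof.
rewrite cd_normsqZ; have := cd_normsqD z (- cd_conj z).
rewrite cd_normsqN cd_normsq_conj; lra.
Qed.

Fact imag_scale_subproof k a (v : imag R k) :
  a *: imag_val v \in @cd_imaginary R k.
Proof. by rewrite inE cd_conjZ -scalerN; case: v => v /= /eqP <-. Qed.

Definition imag_scale k a (v : imag R k) : imag R k :=
  Imag (imag_scale_subproof a v).

End CayleyDicksonTheory.

Section HeisenbergTheory.
Variables (R : realType) (K : hyp_algebra) (n : nat).
Notation H := (heis R K n).
Notation V := 'rV[cd R (level K)]_n.-1.
Implicit Types (p q g : H) (z w : V) (a : R).

Lemma heis_omegaDl z z' w :
  heis_omega (z + z') w = heis_omega z w + heis_omega z' w.
Proof.
rewrite /heis_omega -cd_imD -big_split; congr cd_im.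
by apply: eq_bigr => i _; rewrite mxE cd_mulDr.
Qed.

Lemma heis_omegaC z w : heis_omega w z = - heis_omega z w.
Proof.
rewrite /heis_omega -cd_im_conj cd_conj_sum; congr cd_im.
by apply: eq_bigr => i _; rewrite cd_conjM cd_conjK.
Qed.

Lemma heis_omegaDr z w w' :
  heis_omega z (w + w') = heis_omega z w + heis_omega z w'.
Proof. by rewrite 3!(heis_omegaC _ z) heis_omegaDl opprD. Qed.

Lemma heis_omega0l w : heis_omega 0 w = 0.
Proof. by apply: (addrI (heis_omega 0 w)); rewrite -heis_omegaDl !addr0. Qed.

Lemma heis_omega0r z : heis_omega z 0 = 0.
Proof. by rewrite heis_omegaC heis_omega0l oppr0. Qed.

Lemma heis_omegaNl z w : heis_omega (- z) w = - heis_omega z w.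
Proof.
by apply/eqP; rewrite -addr_eq0 -heis_omegaDl addNr heis_omega0l.
Qed.

Lemma heis_omegaNr z w : heis_omega z (- w) = - heis_omega z w.
Proof. by rewrite 2!(heis_omegaC _ z) heis_omegaNl. Qed.

Lemma heis_omegazz z : heis_omega z z = 0.
Proof.
have : imag_val (heis_omega z z) = - imag_val (heis_omega z z).
  by rewrite {1}heis_omegaC.
move=> /eqP; rewrite -addr_eq0 -mulr2n -scaler_nat scaler_eq0 pnatr_eq0 /=.
by move=> /eqP zz; apply: val_inj.
Qed.

Definition vec_scale a z : V := \row_i (a *: z 0 i).

Lemma vec_scaleD a : {morph vec_scale a : z w / z + w}.
Proof. by move=> z w; apply/rowP => i; rewrite !mxE scalerDr. Qed.

Lemma vec_scaleN a : {morph vec_scale a : z / - z}.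
Proof. by move=> z; apply/rowP => i; rewrite !mxE scalerN. Qed.

Lemma vec_scaleA a b z : vec_scale a (vec_scale b z) = vec_scale (a * b) z.
Proof. by apply/rowP => i; rewrite !mxE scalerA. Qed.

Lemma vec_scale1 z : vec_scale 1 z = z.
Proof. by apply/rowP => i; rewrite mxE scale1r. Qed.

Lemma vec_scale0 a : vec_scale a 0 = 0.
Proof. by apply/rowP => i; rewrite !mxE scaler0. Qed.

Lemma heis_omegaZ a z w :
  heis_omega (vec_scale a z) (vec_scale a w) = imag_scale (a ^+ 2) (heis_omega z w).
Proof.
apply: val_inj; rewrite /= scalerA mulrC -scalerA; congr (_ *: _).
rewrite (_ : \sum_i _ = a ^+ 2 *: \sum_i cd_mul (cd_conj (w 0 i)) (z 0 i)).
  by rewrite cd_conjZ scalerBr.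
rewrite scaler_sumr; apply: eq_bigr => i _.
by rewrite !mxE cd_conjZ cd_mulZl cd_mulZr scalerA.
Qed.

Lemma heis_mulA : associative (@heis_mul R K n).
Proof.
move=> p q g; rewrite /heis_mul /=; congr pair; first exact: addrA.
rewrite heis_omegaDl heis_omegaDr !mulrnDl.
move: (_ *+ 2) (_ *+ 2) (_ *+ 2) => x y z; rewrite -!addrA; do 2!congr (_ + _).
by rewrite [RHS]addrCA; congr (_ + _); rewrite addrCA (addrC x).
Qed.

Lemma heis_mul0 p : heis_mul p (heis0 R K n) = p.
Proof.
by rewrite /heis_mul heis_omega0r mul0rn !addr0 -surjective_pairing.
Qed.

Lemma heis_0mul p : heis_mul (heis0 R K n) p = p.
Proof.
by rewrite /heis_mul heis_omega0l mul0rn !(add0r, addr0) -surjective_pairing.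
Qed.

Lemma heis_mulVp p : heis_mul (heis_inv p) p = heis0 R K n.
Proof.
by rewrite /heis_mul /= heis_omegaNl heis_omegazz oppr0 mul0rn addr0 !addNr.
Qed.

Lemma heis_invK : involutive (@heis_inv R K n).
Proof. by move=> p; rewrite /heis_inv /= !opprK -surjective_pairing. Qed.

Lemma heis_mulpV p : heis_mul p (heis_inv p) = heis0 R K n.
Proof. by rewrite -{1}[p]heis_invK heis_mulVp. Qed.

Lemma heis_invM p q :
  heis_inv (heis_mul p q) = heis_mul (heis_inv q) (heis_inv p).
Proof.
rewrite /heis_inv /heis_mul /=; congr pair; first by rewrite opprD addrC.
rewrite heis_omegaNl heis_omegaNr opprK heis_omegaC mulNrn.
by rewrite [in LHS]opprD opprD [- p.2 + _]addrC opprK.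
Qed.

Lemma heis_mulKp p : cancel (heis_mul p) (heis_mul (heis_inv p)).
Proof. by move=> q; rewrite heis_mulA heis_mulVp heis_0mul. Qed.

Lemma heis_mulVKp p : cancel (heis_mul (heis_inv p)) (heis_mul p).
Proof. by move=> q; rewrite heis_mulA heis_mulpV heis_0mul. Qed.

Lemma koranyi_dist_mul g p q :
  koranyi_dist (heis_mul g p) (heis_mul g q) = koranyi_dist p q.
Proof.
by rewrite /koranyi_dist heis_invM -heis_mulA heis_mulKp.
Qed.

Lemma vec_normE z : vec_norm z ^+ 2 = \sum_i cd_normsq (z 0 i).
Proof.
rewrite sqr_sqrtr; first by apply: eq_bigr => i _; rewrite cd_normE.
by apply: sumr_ge0 => i _; exact: sqr_ge0.
Qed.

Lemma vec_norm_ge0 z : 0 <= vec_norm z.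
Proof. exact: sqrtr_ge0. Qed.

Lemma vec_norm_eq0 z : vec_norm z = 0 -> z = 0.
Proof.
move=> z0; have := vec_normE z; rewrite z0 expr0n => /esym/eqP.
rewrite psumr_eq0; last by move=> i _; exact: cd_normsq_ge0.
move=> /allP z0i; apply/matrixP => i j; rewrite ord1 mxE.
by apply: cd_normsq_eq0; apply/eqP; apply: z0i; rewrite mem_index_enum.
Qed.

Lemma vec_normZ a z : vec_norm (vec_scale a z) ^+ 2 = a ^+ 2 * vec_norm z ^+ 2.
Proof.
by rewrite !vec_normE mulr_sumr; apply: eq_bigr => i _; rewrite mxE cd_normsqZ.
Qed.

Lemma vec_normN z : vec_norm (- z) = vec_norm z.
Proof.
by congr Num.sqrt; apply: eq_bigr => i _; rewrite !cd_normE mxE cd_normsqN.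
Qed.

Definition koranyi_gauge4 p : R :=
  (vec_norm p.1 ^+ 2) ^+ 2 + cd_normsq (imag_val p.2).

Lemma koranyi_gauge4_ge0 p : 0 <= koranyi_gauge4 p.
Proof. by rewrite addr_ge0 ?sqr_ge0 ?cd_normsq_ge0. Qed.

Lemma koranyi_gaugeE p : koranyi_gauge p = koranyi_gauge4 p `^ 4^-1.
Proof. by rewrite /koranyi_gauge cd_normE /koranyi_gauge4 -exprM. Qed.

Lemma koranyi_gauge_ge0 p : 0 <= koranyi_gauge p.
Proof. exact: powR_ge0. Qed.

Lemma powRVrn a (m : nat) : 0 <= a -> (a `^ m.+1%:R^-1) ^+ m.+1 = a.
Proof.
by move=> a0; rewrite -powR_mulrn ?powR_ge0// -powRrM mulVf ?pnatr_eq0// powRr1.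
Qed.

Lemma koranyi_gauge_exp4 p : koranyi_gauge p ^+ 4 = koranyi_gauge4 p.
Proof. by rewrite koranyi_gaugeE powRVrn// koranyi_gauge4_ge0. Qed.

Lemma koranyi_gauge_inv p : koranyi_gauge (heis_inv p) = koranyi_gauge p.
Proof.
by rewrite !koranyi_gaugeE /koranyi_gauge4 vec_normN cd_normsqN.
Qed.

Lemma koranyi_gauge_eq0 p : koranyi_gauge p = 0 -> p = heis0 R K n.
Proof.
move=> p0; have := koranyi_gauge_exp4 p; rewrite p0 expr0n => /esym/eqP.
rewrite paddr_eq0 ?sqr_ge0 ?cd_normsq_ge0// !sqrf_eq0 => /andP[/eqP p1 /eqP p2].
rewrite [p]surjective_pairing (vec_norm_eq0 p1); congr pair.
by apply: val_inj; exact: cd_normsq_eq0.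
Qed.

Lemma koranyi_gauge0 : koranyi_gauge (heis0 R K n) = 0.
Proof.
suff /eqP : koranyi_gauge (heis0 R K n) ^+ 4 = 0 by rewrite expf_eq0 => /eqP.
rewrite koranyi_gauge_exp4 /koranyi_gauge4 /=.
by rewrite vec_normE big1 ?expr0n ?cd_normsq0 ?addr0// => i _; rewrite mxE cd_normsq0.
Qed.

Lemma koranyi_dist0 p : koranyi_dist p (heis0 R K n) = koranyi_gauge p.
Proof. by rewrite /koranyi_dist /heis_inv /= !oppr0 heis_0mul. Qed.

Lemma koranyi_dist_sym p q : koranyi_dist p q = koranyi_dist q p.
Proof.
by rewrite /koranyi_dist -koranyi_gauge_inv heis_invM heis_invK.
Qed.

Definition dilation a p : H := (vec_scale a p.1, imag_scale (a ^+ 2) p.2).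

Lemma dilation_mul a p q :
  dilation a (heis_mul p q) = heis_mul (dilation a p) (dilation a q).
Proof.
rewrite /dilation /heis_mul /=; congr pair; first exact: vec_scaleD.
by apply: val_inj; rewrite heis_omegaZ /= !scalerDr.
Qed.

Lemma dilation_inv a p : dilation a (heis_inv p) = heis_inv (dilation a p).
Proof.
rewrite /dilation /heis_inv /=; congr pair; first exact: vec_scaleN.
by apply: val_inj; rewrite /= scalerN.
Qed.

Lemma dilationA a b p : dilation a (dilation b p) = dilation (a * b) p.
Proof.
rewrite /dilation /= vec_scaleA; congr pair.
by apply: val_inj; rewrite /= scalerA exprMn.
Qed.

Lemma dilation1 p : dilation 1 p = p.
Proof.
rewrite /dilation vec_scale1 [RHS]surjective_pairing; congr pair.
by apply: val_inj; rewrite /= expr1n scale1r.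
Qed.

Lemma dilation0 a : dilation a (heis0 R K n) = heis0 R K n.
Proof.
rewrite /dilation vec_scale0; congr pair.
by apply: val_inj; rewrite /= scaler0.
Qed.

Lemma koranyi_gauge_dilation a p : 0 <= a ->
  koranyi_gauge (dilation a p) = a * koranyi_gauge p.
Proof.
move=> a0; apply/eqP.
rewrite -(@eqrXn2 _ 4) ?mulr_ge0 ?koranyi_gauge_ge0// exprMn.
rewrite !koranyi_gauge_exp4 /koranyi_gauge4 vec_normZ cd_normsqZ exprMn -!exprM.
by rewrite mulrDr.
Qed.

Lemma koranyi_dist_dilation a p q : 0 <= a ->
  koranyi_dist (dilation a p) (dilation a q) = a * koranyi_dist p q.
Proof.
move=> a0; rewrite /koranyi_dist -dilation_inv -dilation_mul.
exact: koranyi_gauge_dilation.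
Qed.

Lemma koranyi_gauge_mul_bounded g b :
  exists b', forall p, koranyi_gauge p <= b -> koranyi_gauge (heis_mul g p) <= b'.
Proof.
set k := level K; set m := n.-1.
pose s := Num.sqrt (b ^+ 4).
pose v1 := 2 * vec_norm g.1 ^+ 2 + 2 * s.
pose om := 2 ^+ m * (4 ^+ k * (s * vec_norm g.1 ^+ 2)).
pose v2 := 2 * (2 * cd_normsq (imag_val g.2) + 2 * b ^+ 4) + 2 * (4 * om).
exists ((v1 ^+ 2 + v2) `^ 4^-1) => p pb.
have {pb} p4 : koranyi_gauge4 p <= b ^+ 4.
  rewrite -koranyi_gauge_exp4 lerXn2r// nnegrE ?koranyi_gauge_ge0//.
  exact: le_trans (koranyi_gauge_ge0 p) pb.
have pv : cd_normsq (imag_val p.2) <= b ^+ 4.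
  by apply: le_trans p4; rewrite lerDr sqr_ge0.
have ps : vec_norm p.1 ^+ 2 <= s.
  rewrite -(@ger0_norm _ (vec_norm p.1 ^+ 2)) ?sqr_ge0// -sqrtr_sqr ler_wsqrtr//.
  by apply: le_trans p4; rewrite lerDl cd_normsq_ge0.
have p0 := koranyi_gauge4_ge0 (heis_mul g p).
rewrite koranyi_gaugeE ge0_ler_powR ?invr_ge0 ?nnegrE//; last first.
  rewrite lerD//.
    rewrite lerXn2r ?nnegrE ?sqr_ge0 ?addr_ge0 ?mulr_ge0 ?sqr_ge0 ?sqrtr_ge0//.
    rewrite (@le_trans _ _ (2 * vec_norm g.1 ^+ 2 + 2 * vec_norm p.1 ^+ 2))//.
      rewrite !vec_normE !mulr_sumr -big_split; apply: ler_sum => i _.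
      by rewrite mxE cd_normsqD.
    by rewrite lerD2l ler_pM2l.
  apply: le_trans (cd_normsqD _ _) _; rewrite lerD// ler_pM2l//.
    by apply: le_trans (cd_normsqD _ _) _; rewrite lerD2l ler_pM2l.
  rewrite [X in cd_normsq X](_ : _ = 2 *: imag_val (heis_omega g.1 p.1)); last first.
    by rewrite scaler_nat.
  rewrite cd_normsqZ (_ : 2 ^+ 2 = 4); last by rewrite -natrX.
  rewrite ler_pM2l//; apply: le_trans (cd_normsq_im _) _.
  apply: le_trans (cd_normsq_sum _) _; rewrite ler_pM2l ?exprn_gt0//.
  apply: (@le_trans _ _ (\sum_i 4 ^+ k * (s * cd_normsq (g.1 0 i)))); last first.
    by rewrite -!mulr_sumr -vec_normE.
  apply: ler_sum => i _; apply: le_trans (cd_normsqM _ _) _.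
  rewrite cd_normsq_conj ler_pM2l ?exprn_gt0// ler_wpM2r ?cd_normsq_ge0//.
  apply: le_trans ps; rewrite vec_normE (bigD1 i)//= lerDl sumr_ge0// => j _.
  exact: cd_normsq_ge0.
have om0 : 0 <= om.
  by rewrite !mulr_ge0 ?exprn_ge0 ?sqr_ge0 ?sqrtr_ge0.
have := cd_normsq_ge0 (imag_val g.2); have := le_trans (cd_normsq_ge0 _) pv.
have := sqr_ge0 v1; rewrite /v2; lra.
Qed.

End HeisenbergTheory.

Section MultiplicativeMaps.
Variable R : realType.

Lemma additive_pos_linear (f : R -> R) :
    {morph f : x y / x + y} -> (forall x, x < 0 -> f x < 0) ->
  forall x, f x = f 1 * x.
Proof.
move=> fD fneg x.
have f0 : f 0 = 0 by apply: (addrI (f 0)); rewrite -fD !addr0.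
have fN y : f (- y) = - f y by apply/eqP; rewrite -addr_eq0 -fD addNr f0.
have fMn y m : f (y *+ m) = f y *+ m.
  by elim: m => [|m IH]; rewrite ?mulr0n// !mulrS fD IH.
have fZ (m : int) : f m%:~R = f 1 * m%:~R.
  by rewrite mulrzr; case: m => m; rewrite /intmul/= ?fN fMn.
have fhomo y z : y <= z -> f y <= f z.
  rewrite le_eqVlt => /orP[/eqP->//|yz].
  by rewrite ltW// -subr_lt0 -fN -fD fneg// subr_lt0.
have f1 : 0 < f 1 by rewrite -oppr_lt0 -fN fneg// oppr_lt0.
apply/eqP; rewrite -subr_eq0; apply/negPn/negP => e0.
set e := _ - _ in e0; have {}e0 : 0 < `|e| by rewrite normr_gt0.
pose m := Num.bound (f 1 / `|e|).
have me : f 1 < m%:R * `|e|.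
  by rewrite -ltr_pdivrMr// archi_boundP// divr_ge0// ltW.
pose l := Num.floor (m%:R * x).
have /andP[l1 l2] := @floor_itv R (m%:R * x).
have fmx : f (m%:R * x) = m%:R * f x by rewrite !mulr_natl fMn.
have := fhomo _ _ l1; have := fhomo _ _ (ltW l2).
rewrite fmx !fZ => h2 h1.
have : `|m%:R * e| <= f 1.
  rewrite ler_norml /e mulrBr; rewrite intrD1 in h2 l2.
  have := ler_wpM2l (ltW f1) l1; have := ler_wpM2l (ltW f1) (ltW l2).
  rewrite mulrCA; lra.
by rewrite normrM normr_nat leNgt me.
Qed.

Lemma multiplicative_powR (k : R -> R) :
    (forall a b, 0 < a -> 0 < b -> k (a * b) = k a * k b) ->
    (forall a, 0 < a -> 0 < k a) -> (forall a, 0 < a < 1 -> k a < 1) ->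
  exists2 alpha, 0 < alpha & forall a, 0 < a -> k a = a `^ alpha.
Proof.
move=> kM k0 k1; pose f x := ln (k (expR x)).
have fD : {morph f : x y / x + y}.
  by move=> x y; rewrite /f expRD kM ?expR_gt0// lnM ?posrE ?k0 ?expR_gt0.
have fneg x : x < 0 -> f x < 0.
  by move=> x0; rewrite ln_lt0// k0 ?k1 ?expR_gt0//= expR_lt1.
have fE := additive_pos_linear fD fneg.
exists (f 1).
  by have := fneg (- 1); rewrite fE mulrN1 !oppr_lt0 => ->.
move=> a a0; rewrite /powR gt_eqF// -[LHS]lnK ?posrE ?k0//; congr expR.
by rewrite -fE /f lnK.
Qed.

End MultiplicativeMaps.

Section KoranyiSimilarities.
Variables (R : realType) (K : hyp_algebra) (n : nat).
Notation H := (heis R K n).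
Implicit Types (f g : H -> H) (c : R) (p q : H).

Definition koranyi_bounded f := forall b : R,
  exists b', forall p, koranyi_gauge p <= b -> koranyi_gauge (f p) <= b'.

Lemma continuous_koranyi_similarity f g c :
    cancel f g -> 0 < c ->
    (forall p q, koranyi_dist (f p) (f q) = c * koranyi_dist p q) ->
    koranyi_bounded g ->
  continuous (omap f : ext_space koranyi_dist -> ext_space koranyi_dist).
Proof.
move=> fK c0 fc gb; apply/continuousP => A oA.
suff : ext_open koranyi_dist (omap f @^-1` A) by [].
have {}oA : ext_open koranyi_dist A := oA.
move=> x /oA[e e0 eA].
case: x eA => [p|] eA.
  exists (e / c); first by rewrite divr_gt0.
  move=> _ [q /= pq <-]; apply: eA; exists (f q) => //=.
  by rewrite fc mulrC -ltr_pdivlMr.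
have [b gbb] := gb e; exists (Num.max b 1); first by rewrite lt_max ltr01 orbT.
move=> _ [->|[q /= + <-]]; first by apply: eA; left.
rewrite gt_max koranyi_dist_sym koranyi_dist0 => /andP[bq _].
apply: eA; right; exists (f q) => //=.
rewrite koranyi_dist_sym koranyi_dist0 ltNge; apply/negP => /gbb.
by rewrite fK leNgt bq.
Qed.

Lemma koranyi_similarity f g c :
    cancel f g -> cancel g f -> 0 < c ->
    (forall p q, koranyi_dist (f p) (f q) = c * koranyi_dist p q) ->
    koranyi_bounded f -> koranyi_bounded g ->
  sim_group koranyi_dist (omap f : boundary R K n -> boundary R K n).
Proof.
move=> fK gK c0 fc fb gb; have cN0 : c != 0 by rewrite gt_eqF.
have gc p q : koranyi_dist (g p) (g q) = c^-1 * koranyi_dist p q.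
  by rewrite -{2}[p]gK -{2}[q]gK fc mulKf.
split; last by exists c => // p q /=; rewrite fc EFinM.
split.
  split; first exact: (@continuous_koranyi_similarity f g c).
  exists (omap g); split.
  - by case=> //= p; rewrite fK.
  - by case=> //= p; rewrite gK.
  - by apply: (@continuous_koranyi_similarity g f c^-1); rewrite ?invr_gt0.
pose w (x y : boundary R K n) := if (x, y) is (Some _, Some _) then c else 1.
have wE x y : cross_factor koranyi_dist (omap f x) (omap f y) =
              w x y * cross_factor koranyi_dist x y.
  by case: x y => [p|] [q|]; rewrite /cross_factor/w/= ?fc ?mul1r.
move=> x1 x2 x3 x4; rewrite /= !inE !negb_or => u.
have wr : w x4 x2 / w x4 x1 * (w x3 x1 / w x3 x2) = 1.
  by case: x1 x2 x3 x4 u => [?|] [?|] [?|] [?|]; rewrite ?eqxx ?andbF //= => _;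
    rewrite ?divff ?oner_eq0 ?mulr1 ?mul1r ?divr1 ?divff ?mulVf.
rewrite /cross_ratio !wE -[RHS]mul1r -wr !invfM.
ring.
Qed.

End KoranyiSimilarities.

Section BasicSimilarities.
Variables (R : realType) (K : hyp_algebra) (n : nat).
Notation H := (heis R K n).

Lemma translation_similarity (g : H) :
  sim_group koranyi_dist (omap (heis_mul g) : boundary R K n -> boundary R K n).
Proof.
apply: (@koranyi_similarity _ _ _ _ (heis_mul (heis_inv g)) 1) => //.
- exact: heis_mulKp.
- exact: heis_mulVKp.
- by move=> p q; rewrite koranyi_dist_mul mul1r.
- exact: koranyi_gauge_mul_bounded.
- exact: koranyi_gauge_mul_bounded.
Qed.

Lemma dilation_bounded (a : R) : 0 < a -> koranyi_bounded (@dilation R K n a).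
Proof.
move=> a0 b; exists (a * b) => p.
by rewrite koranyi_gauge_dilation ?(ltW a0)// ler_pM2l.
Qed.

Lemma dilation_similarity (a : R) : 0 < a ->
  sim_group koranyi_dist (omap (dilation a) : boundary R K n -> boundary R K n).
Proof.
move=> a0; apply: (@koranyi_similarity _ _ _ _ (dilation a^-1) a) => //.
- by move=> p; rewrite dilationA mulVf ?gt_eqF// dilation1.
- by move=> p; rewrite dilationA mulfV ?gt_eqF// dilation1.
- by move=> p q; rewrite koranyi_dist_dilation// ltW.
- exact: dilation_bounded.
- by apply: dilation_bounded; rewrite invr_gt0.
Qed.

End BasicSimilarities.

Section Reflections.
Variables (R : realType) (n : nat).
Notation H := (heis R Reals n).
Notation V := 'rV[cd R (level Reals)]_n.-1.
Implicit Types (x y u : V) (a : R).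

Lemma imag_real_eq0 (v : imag R (level Reals)) : v = 0.
Proof.
apply: val_inj; case: v => v /= /eqP /= vN.
have {}vN : (v : R) = - (v : R) := vN.
by suff : (v : R) = 0; [|lra].
Qed.

Lemma koranyi_gauge_real (p : H) : koranyi_gauge p = vec_norm p.1.
Proof.
apply/eqP; rewrite -(@eqrXn2 _ 4) ?koranyi_gauge_ge0 ?vec_norm_ge0//.
rewrite koranyi_gauge_exp4 /koranyi_gauge4 (imag_real_eq0 p.2).
by rewrite cd_normsq0 addr0 -exprM.
Qed.

Definition dot x y : R := \sum_i (x 0 i : R) * (y 0 i : R).

Lemma dotxx x : dot x x = vec_norm x ^+ 2.
Proof. by rewrite vec_normE. Qed.

Lemma dotC x y : dot x y = dot y x.
Proof. by apply: eq_bigr => i _; rewrite mulrC. Qed.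

Lemma dotDl x y u : dot (x + y) u = dot x u + dot y u.
Proof. by rewrite -big_split; apply: eq_bigr => i _; rewrite mxE; exact: mulrDl. Qed.

Lemma dotZl a x u : dot (vec_scale a x) u = a * dot x u.
Proof.
rewrite mulr_sumr; apply: eq_bigr => i _.
by rewrite mxE; exact: esym (mulrA _ _ _).
Qed.

Lemma dotNl x u : dot (- x) u = - dot x u.
Proof. by rewrite -sumrN; apply: eq_bigr => i _; rewrite mxE; exact: mulNr. Qed.

Lemma dotxx_eq0 x : (dot x x == 0) = (x == 0).
Proof.
apply/eqP/eqP => [|->]; last first.
  by apply: big1 => i _; rewrite mxE; exact: mul0r.
by rewrite dotxx => /eqP; rewrite sqrf_eq0 => /eqP/vec_norm_eq0.
Qed.

Definition reflection u x := x - vec_scale (2 * dot x u / dot u u) u.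

Lemma reflectionB u x y : reflection u (x - y) = reflection u x - reflection u y.
Proof.
apply/rowP => i; rewrite /reflection !mxE dotDl dotNl.
rewrite mulrBr mulrBl scalerBl opprD opprK addrACA; congr (_ + _).
by rewrite opprB addrC.
Qed.

Lemma reflection0 u : reflection u 0 = 0.
Proof. by have := reflectionB u 0 0; rewrite !subrr. Qed.

Lemma dot_reflection u x : u != 0 -> dot (reflection u x) u = - dot x u.
Proof.
rewrite -dotxx_eq0 => u0; rewrite dotDl dotNl dotZl divfK//; ring.
Qed.

Lemma reflectionK u : u != 0 -> involutive (reflection u).
Proof.
move=> u0 x; rewrite {1}/reflection dot_reflection// /reflection.
apply/rowP => i; rewrite !mxE mulrN mulNr scaleNr opprK.
by rewrite subrK.
Qed.

Lemma vec_norm_reflection u x : u != 0 -> vec_norm (reflection u x) = vec_norm x.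
Proof.
move=> u0; apply/eqP; rewrite -(@eqrXn2 _ 2) ?vec_norm_ge0// -!dotxx.
rewrite {1}/reflection dotDl dotNl dotZl [dot u (reflection u x)]dotC dot_reflection//.
rewrite [dot x (reflection u x)]dotC /reflection dotDl dotNl dotZl [dot u x]dotC.
by apply/eqP; ring.
Qed.

Lemma reflection_swap x y : vec_norm x = vec_norm y -> x != y ->
  reflection (x - y) x = y.
Proof.
move=> xy; rewrite -subr_eq0 => u0; rewrite /reflection.
rewrite (_ : 2 * _ / _ = 1); first by rewrite vec_scale1 opprB addrC subrK.
rewrite -dotxx_eq0 in u0; apply: (canLR (mulfK u0)); rewrite mul1r.
rewrite [RHS]dotDl dotNl ![dot _ (x - y)]dotC !dotDl !dotNl !dotxx xy.
rewrite [dot y x]dotC; ring.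
Qed.

Definition heis_reflection u (p : H) : H := (reflection u p.1, p.2).

Lemma reflection_similarity u : u != 0 ->
  sim_group koranyi_dist
    (omap (heis_reflection u) : boundary R Reals n -> boundary R Reals n).
Proof.
move=> u0.
have uK : involutive (heis_reflection u).
  by move=> p; rewrite /heis_reflection/= reflectionK// -surjective_pairing.
have ub : koranyi_bounded (heis_reflection u).
  by move=> b; exists b => p; rewrite !koranyi_gauge_real vec_norm_reflection.
apply: (@koranyi_similarity _ _ _ _ (heis_reflection u) 1) => //.
move=> p q; rewrite mul1r /koranyi_dist !koranyi_gauge_real /=.
by rewrite ![- _ + _]addrC -reflectionB vec_norm_reflection.
Qed.

End Reflections.

Lemma powR_div (R : realType) (a b x : R) : 0 <= a -> 0 <= b ->
  (a / b) `^ x = a `^ x / b `^ x.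
Proof.
by move=> a0 b0; rewrite powRM ?invr_ge0// -(powR_inv1 b0) -powRrM mulN1r powRN.
Qed.

Section InvariantMetrics.
Variables (R : realType) (K : hyp_algebra) (n : nat).
Notation H := (heis R K n).
Notation o := (heis0 R K n).
Variable d : H -> H -> R.
Hypothesis hd : is_metric d.
Hypothesis hSim : sim_group koranyi_dist `<=` sim_group d.
Hypothesis hTop : forall u : nat -> boundary R K n,
  converges koranyi_dist u -> converges d u.

Let d0 p : d p p = 0. Proof. exact: (metric_eq0 hd p p).2. Qed.

Let d_gt0 p q : p <> q -> 0 < d p q.
Proof.
move=> pq; rewrite lt_neqAle metric_ge0// andbT eq_sym.
by apply/eqP => /(metric_eq0 hd p q).1.
Qed.

Lemma sim_scale (f : H -> H) :
    sim_group koranyi_dist (omap f : boundary R K n -> boundary R K n) ->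
  exists2 c, 0 < c & forall p q, d (f p) (f q) = c * d p q.
Proof.
by move=> /hSim[_ [c c0 fc]]; exists c => // p q; have [] := fc p q.
Qed.

(* Conjugating the translation by g with the dilation squares it, but leaves
   its similarity constant unchanged. *)
Lemma dist_mul_square a g p q : 0 < a -> dilation a g = heis_mul g g ->
  d (heis_mul g p) (heis_mul g q) = d p q.
Proof.
move=> a0 ag; have [->|/eqP/d_gt0 pq] := eqVneq p q; first by rewrite !d0.
have [c c0 dc] := sim_scale (dilation_similarity K n a0).
have [t t0 gt] := sim_scale (translation_similarity g).
have := dc (heis_mul g p) (heis_mul g q).
rewrite !dilation_mul ag -!heis_mulA !gt dc => /eqP.
rewrite -subr_eq0 (_ : _ - _ = c * t * d p q * (t - 1)); last by ring.
rewrite !mulf_eq0 (gt_eqF c0) (gt_eqF t0) (gt_eqF pq) /= subr_eq0 => /eqP ->.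
by rewrite mul1r.
Qed.

Lemma dist_mul g p q : d (heis_mul g p) (heis_mul g q) = d p q.
Proof.
have -> : g = heis_mul (g.1, 0) (0, g.2).
  by rewrite /heis_mul/= heis_omega0r mul0rn !addr0 add0r -surjective_pairing.
rewrite -!heis_mulA (@dist_mul_square 2)//; last first.
  rewrite /dilation /heis_mul /= heis_omegazz mul0rn !addr0; congr pair.
    by apply/rowP => i; rewrite !mxE scaler_nat mulr2n.
  by apply: val_inj; rewrite /= scaler0.
rewrite (@dist_mul_square (Num.sqrt 2)) ?sqrtr_gt0//.
rewrite /dilation /heis_mul /= heis_omega0r mul0rn !addr0 sqr_sqrtr//; congr pair.
  exact: vec_scale0.
by apply: val_inj; rewrite /= scaler_nat mulr2n.
Qed.

Lemma distE p q : d p q = d (heis_mul (heis_inv q) p) o.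
Proof. by rewrite -(heis_mulVp q) dist_mul. Qed.

(* (Top) does not say that the two limits agree: interleaving the sequence with
   the constant o forces this. *)
Lemma dist_near0 e : 0 < e ->
  exists2 eps, 0 < eps & forall p, koranyi_gauge p < eps -> d p o < e.
Proof.
move=> e0; apply/not_exists2P => far.
have /choice[u uP] (m : nat) : exists p : H,
    koranyi_gauge p < m.+1%:R^-1 /\ e <= d p o.
  case: (far m.+1%:R^-1) => [|nP]; first by rewrite invr_gt0.
  apply: contrapT => /forallNP pP; apply: nP => p pm.
  by rewrite ltNge; apply/negP => ep; apply: (pP p).
pose w (m : nat) : boundary R K n := Some (if odd m then o else u m./2).
have [|l wl] := hTop (u := w).
  exists (Some o : ext_space koranyi_dist) => A [B [oB Bo BA]].
  have {}oB : ext_open koranyi_dist B := oB.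
  have [r r0 rB] := oB _ Bo.
  have [N _ Nr] := near_infty_natSinv_lt (PosNum r0).
  exists N.*2 => // m /= Nm; apply/BA/rB.
  exists (if odd m then o else u m./2) => //=.
  rewrite koranyi_dist_sym koranyi_dist0; case: ifP => _.
    by rewrite koranyi_gauge0.
  apply: lt_trans (uP _).1 _; apply: Nr => /=.
  by rewrite -(doubleK N) half_leq.
have wnear A : nbhs l A -> exists N, forall m, (N <= m)%N -> A (w m).
  by move=> /wl[N _ NA]; exists N.
case: l wl wnear => [q|] wl wnear.
  have [|N Nq] := wnear (basic_nbhs d (Some q) (e / 2)).
    by apply/nbhs_ext_spaceE => //; exists (e / 2); rewrite ?divr_gt0.
  have [] := Nq N.*2; first by rewrite -addnn leq_addr.
  rewrite /w odd_double doubleK => p /= qp [] pu.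
  have [] := Nq N.*2.+1; first by rewrite -addnn -addnS leq_addr.
  rewrite /w /= odd_double /= => p' /= qp' [] po.
  have := Defs.metric_triangle hd (u N) q o.
  rewrite (Defs.metric_sym hd (u N) q) -pu -po.
  by have := (uP N).2; rewrite -pu -po; lra.
have [|N Nq] := wnear (basic_nbhs d (infinity R K n) 1).
  by apply/nbhs_ext_spaceE => //; exists 1.
have [] := Nq N.*2.+1; first by rewrite -addnn -addnS leq_addr.
  by [].
by rewrite /w /= odd_double /= => -[p /= + [po]]; rewrite po d0 ltr10.
Qed.

Lemma exists_neq0 : (2 <= n)%N -> exists z : 'rV[cd R (level K)]_n.-1, z <> 0.
Proof.
move=> n2; have [x x0] : exists x : cd R (level K), x <> 0.
  elim: (level K) => [|k [x x0]]; first by exists (1 : R); apply/eqP/oner_neq0.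
  by exists (x, 0) => -[].
exists (const_mx x) => /rowP z0; apply: x0.
have n1 : (0 < n.-1)%N by rewrite -ltnS prednK// (leq_trans _ n2).
by have := z0 (Ordinal n1); rewrite !mxE.
Qed.

Lemma dist_dilation : (2 <= n)%N ->
  exists2 alpha, 0 < alpha <= 1 &
    forall a p q, 0 < a -> d (dilation a p) (dilation a q) = a `^ alpha * d p q.
Proof.
move=> /exists_neq0[z z0]; pose p0 : H := (z, 0).
have N0 : 0 < d p0 o by apply: d_gt0 => -[].
have /choice[k kP] (a : R) : exists c, 0 < a -> 0 < c /\
    forall p q, d (dilation a p) (dilation a q) = c * d p q.
  have [a0|] := ltP 0 a; last by exists 0.
  have [c c0 ac] := sim_scale (dilation_similarity K n a0).
  by exists c.
have kM a b : 0 < a -> 0 < b -> k (a * b) = k a * k b.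
  move=> a0 b0; apply: (mulIf (lt0r_neq0 N0)).
  rewrite -(kP _ (mulr_gt0 a0 b0)).2 -!dilationA.
  by rewrite (kP _ a0).2 (kP _ b0).2 mulrA.
have [|a /andP[a0 a1]|alpha alpha0 kE] := multiplicative_powR kM.
- by move=> a /kP[].
- have [eps eps0 near0] := dist_near0 N0.
  have kX m : d (dilation (a ^+ m) p0) o = k a ^+ m * d p0 o.
    elim: m => [|m IH]; first by rewrite !expr0 dilation1 mul1r.
    by rewrite !exprS -dilationA -[X in d _ X](dilation0 K n a) (kP _ a0).2 IH mulrA.
  rewrite ltNge; apply/negP => ka.
  have [m] : exists m, a ^+ m * koranyi_gauge p0 < eps.
    have g0 := koranyi_gauge_ge0 p0.
    have e0 : 0 < eps / (koranyi_gauge p0 + 1) by rewrite divr_gt0// ltr_wpDl.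
    have /cvg_expr/cvgr0_norm_lt/(_ _ e0)[m _ /(_ m (leqnn m)) /= am] : `|a| < 1.
      by rewrite ger0_norm// ltW.
    exists m; move: am; rewrite ger0_norm ?exprn_ge0 ?ltW// ltr_pdivlMr ?ltr_wpDl//.
    apply: le_lt_trans; rewrite ler_wpM2l ?exprn_ge0 ?(ltW a0)// lerDl//.
  rewrite -koranyi_gauge_dilation ?exprn_ge0 ?(ltW a0)// => /near0.
  by rewrite kX ltNge ler_peMl ?exprn_ege1// ltW.
exists alpha; last by move=> a p q a0; rewrite (kP _ a0).2 kE.
rewrite alpha0 leNgt; apply/negP => alpha1.
have : k 2 <= 2.
  rewrite -(ler_pM2r N0) -(kP 2 _).2// dilation0 mulrDl mul1r.
  have -> : dilation 2 p0 = heis_mul p0 p0.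
    rewrite /dilation /heis_mul /= heis_omegazz mul0rn !addr0; congr pair.
      by apply/rowP => i; rewrite !mxE scaler_nat mulr2n.
    by apply: val_inj; rewrite /= scaler0.
  have := Defs.metric_triangle hd (heis_mul p0 p0) (heis_mul p0 o) o.
  by rewrite dist_mul heis_mul0.
rewrite kE// -ler_ln ?posrE ?powR_gt0// ln_powR leNgt.
by rewrite ltr_pMl ?ln_gt0 ?ltr1n// alpha1.
Qed.

Lemma dist_le_koranyi alpha : 0 < alpha ->
    (forall a p q, 0 < a ->
      d (dilation a p) (dilation a q) = a `^ alpha * d p q) ->
  exists2 beta, 0 < beta & forall p q, d p q <= beta * koranyi_dist p q `^ alpha.
Proof.
move=> alpha0 dD; have [eps eps0 near0] := dist_near0 ltr01.
have e0 : 0 < eps / 2 by rewrite divr_gt0.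
exists ((eps / 2) `^ alpha)^-1; first by rewrite invr_gt0 powR_gt0.
move=> p q; rewrite distE /koranyi_dist; set r := heis_mul _ p.
have [r0|rN0] := eqVneq (koranyi_gauge r) 0.
  by rewrite (koranyi_gauge_eq0 r0) koranyi_gauge0 powR0 ?gt_eqF// mulr0 d0.
have r0 : 0 < koranyi_gauge r by rewrite lt_neqAle eq_sym rN0 koranyi_gauge_ge0.
have a0 : 0 < eps / 2 / koranyi_gauge r by rewrite divr_gt0.
have /ltW : d (dilation (eps / 2 / koranyi_gauge r) r) o < 1.
  apply: near0; rewrite koranyi_gauge_dilation ?(ltW a0)// divfK// -subr_gt0; lra.
rewrite -[X in d _ X](dilation0 K n (eps / 2 / koranyi_gauge r)) dD//.
rewrite (powR_div _ (ltW e0) (ltW r0)).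
by rewrite mulrAC (ler_pdivrMr _ _ (powR_gt0 _ r0)) mul1r -ler_pdivlMl ?powR_gt0.
Qed.

End InvariantMetrics.

Theorem theorem1p1 (R : realType) (K : hyp_algebra) (n : nat)
    (hn : (2 <= n)%N) (hO : K = Octonions -> n = 2%N)
    (d : heis R K n -> heis R K n -> R) (hd : is_metric d)
    (hSim : sim_group koranyi_dist `<=` sim_group d)
    (hTop : forall u : nat -> boundary R K n,
        converges koranyi_dist u -> converges d u) :
  (K = Reals ->
    exists beta alpha : R,
      [/\ 0 < beta, 0 < alpha <= 1 &
        forall x y : boundary R K n,
          (ext_dist d x y = beta%:E * ext_dist koranyi_dist x y `^ alpha)%E]) /\
  (K <> Reals ->
    exists alpha beta : R,
      [/\ 0 < alpha <= 1, 0 < beta &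
        forall x y : boundary R K n,
          (ext_dist d x y <= beta%:E * ext_dist koranyi_dist x y `^ alpha)%E]).
Proof.
have [alpha /andP[alpha0 alpha1] dD] := dist_dilation hd hSim hTop hn.
have aN0 : alpha != 0 by rewrite gt_eqF.
split=> [KR|_]; last first.
  have [beta beta0 dle] := dist_le_koranyi hd hSim hTop alpha0 dD.
  exists alpha, beta; split=> //; first by rewrite alpha0.
  case=> [p|] [q|]; rewrite /ext_dist ?poweR_EFin -?EFinM ?lee_fin//.
  - by rewrite poweRyr// gt0_muley// lte_fin.
  - by rewrite poweRyr// gt0_muley// lte_fin.
  - by rewrite powR0// mulr0.
subst K; have [z z0] := exists_neq0 R Reals hn.
have zg : 0 < vec_norm z.
  by rewrite lt_neqAle vec_norm_ge0 andbT eq_sym; apply/eqP => /vec_norm_eq0.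
set o := heis0 R Reals n; pose p0 : heis R Reals n := (z, 0).
have N0 : 0 < d p0 o.
  rewrite lt_neqAle metric_ge0// andbT eq_sym.
  by apply/eqP => /(metric_eq0 hd p0 o).1[].
have same_norm p : vec_norm p.1 = vec_norm z -> d p o = d p0 o.
  move=> pz; have [zp|zp] := eqVneq z p.1.
    by congr (d _ o); rewrite [p]surjective_pairing -zp (imag_real_eq0 p.2).
  have u0 : z - p.1 != 0 by rewrite subr_eq0.
  have [c c0 dc] := sim_scale hSim (reflection_similarity u0).
  have ro : heis_reflection (z - p.1) o = o.
    by rewrite /heis_reflection reflection0.
  have := dc p0 o; have := dc p o; rewrite ro.
  have -> : heis_reflection (z - p.1) p0 = p.
    rewrite [RHS]surjective_pairing (imag_real_eq0 p.2).
    by rewrite /heis_reflection reflection_swap.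
  have -> : heis_reflection (z - p.1) p = p0.
    rewrite /p0 /heis_reflection (imag_real_eq0 p.2).
    by rewrite -{2}(reflection_swap (esym pz) zp) reflectionK.
  move=> e1 e2; have : c ^+ 2 = 1.
    by apply: (mulIf (lt0r_neq0 N0)); rewrite mul1r expr2 -mulrA -e2.
  move=> /eqP; rewrite sqrf_eq1 => /orP[/eqP c1|/eqP c1].
    by rewrite e2 c1 mul1r.
  by move: c0; rewrite c1 oppr_gt0 ltr10.
exists (d p0 o / vec_norm z `^ alpha), alpha; split.
- by rewrite divr_gt0 ?powR_gt0.
- by rewrite alpha0.
have dE p q : d p q = d p0 o / vec_norm z `^ alpha * koranyi_dist p q `^ alpha.
  rewrite (distE hd hSim) /koranyi_dist; set r := heis_mul _ p.
  have [r0|rN0] := eqVneq (koranyi_gauge r) 0.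
    rewrite (koranyi_gauge_eq0 r0) koranyi_gauge0 powR0// mulr0.
    exact: (metric_eq0 hd _ _).2.
  rewrite koranyi_gauge_real in rN0 *.
  have r0 : 0 < vec_norm r.1 by rewrite lt_neqAle eq_sym rN0 vec_norm_ge0.
  pose a := vec_norm z / vec_norm r.1.
  have a0 : 0 < a by rewrite divr_gt0.
  rewrite -(same_norm (dilation a r)); last first.
    by rewrite -koranyi_gauge_real koranyi_gauge_dilation ?(ltW a0)//
      koranyi_gauge_real divfK.
  have := dD a r o a0; rewrite dilation0 => ->.
  rewrite /a (powR_div _ (ltW zg) (ltW r0)).
  move: (powR_gt0 alpha zg) (powR_gt0 alpha r0) => /lt0r_neq0 + /lt0r_neq0.
  move: (vec_norm z `^ _) (vec_norm r.1 `^ _) (d r o) => A B D A0 B0.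
  by field; rewrite A0 B0.
have beta0 : 0 < d p0 o / vec_norm z `^ alpha by rewrite divr_gt0 ?powR_gt0.
case=> [p|] [q|]; rewrite /ext_dist.
- by rewrite poweR_EFin -EFinM -dE.
- by rewrite poweRyr// gt0_muley// lte_fin.
- by rewrite poweRyr// gt0_muley// lte_fin.
- by rewrite poweR_EFin powR0// mule0.
Qed.
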